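(* Let $m,n,\ell\ge 0$ be integers such that $n+\ell\ge m$. Let $\mathcal R^{\ge 1-\ell}_{m,n}$ be the set of partitions $\lambda$ with at most $m$ parts and largest part at most $n$, all of whose successive ranks are at least $1-\ell$. Then \[ \sum_{\lambda\in \mathcal R_{m,n}^{\ge 1-\ell}} t^{d(\lambda)}q^{|\lambda|}= \sum_{i\ge0} t^i q^{i^2}\left(\begin{bmatrix}n\\ i\end{bmatrix}_q\begin{bmatrix}m\\ i\end{bmatrix}_q-q^\ell\begin{bmatrix}n+\ell-1\\ i-1\end{bmatrix}_q\begin{bmatrix}m-\ell+1\\ i+1\end{bmatrix}_q\right). \]
   Context: A partition $\lambda=(\lambda_1\ge\lambda_2\ge\dots\ge\lambda_k)$ is a weakly decreasing (possibly empty) sequence of positive integers; $|\lambda|=\sum_i\lambda_i$; $k$ is its number of parts; $\lambda_i=0$ for $i>k$. The conjugate $\lambda'$ has parts $\lambda'_j=|\{i:\lambda_i\ge j\}|$. The side of the Durfee square is $d(\lambda)=\max\{i\ge 1:\lambda_i\ge i\}$ (and $d(\emptyset)=0$). For $1\le i\le d(\lambda)$, the $i$th successive rank is $r_i(\lambda)=\lambda_i-\lambda'_i$. The empty partition has no ranks, so it satisfies every condition of the form ''all ranks are at least $b$''. Notation: $(q)_n=\prod_{i=1}^n(1-q^i)$, and $\begin{bmatrix}n\\k\end{bmatrix}_q=\frac{(q)_n}{(q)_k(q)_{n-k}}$ if $0\le k\le n$, and $\begin{bmatrix}n\\k\end{bmatrix}_q=0$ otherwise (including for negative $n$ or $k$).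 Here $q,t$ are formal variables. *)

(* Defs.v *)
From HB Require Import structures.
From mathcomp Require Import all_boot all_order all_algebra.
From mathcomp Require Import boolp classical_sets fsbigop.

Set Implicit Arguments.
Unset Strict Implicit.
Unset Printing Implicit Defensive.

Import Order.TTheory GRing.Theory Num.Theory.
Local Open Scope ring_scope.

(* Parts and ranks are indexed from 1; the value at index 0 is never used. *)

Definition is_partition (la : seq nat) : bool := sorted geq la && (0%N \notin la).

Definition part (la : seq nat) (i : nat) : nat := nth 0%N la i.-1.

Definition conj_part (la : seq nat) (j : nat) : nat := count (leq j) la.

(* An index i >= 1 with i <= part la i is at most size la, and the empty
   maximum is 0. *)
Definition durfee (la : seq nat) : nat :=
  \max_(1 <= i < (size la).+1 | (i <= part la i)%N) i.

Definition srank (la : seq nat) (i : nat) : int :=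
  (part la i)%:Z - (conj_part la i)%:Z.

(* The lower bound b on the ranks is an arbitrary integer. *)
Definition ranked_partitions (m n : nat) (b : int) : set (seq nat) :=
  [set la | [/\ is_partition la, (size la <= m)%N, (part la 1 <= n)%N &
             forall i : nat, (1 <= i <= durfee la)%N -> b <= srank la i]]%classic.

(* The field Q(q, t), as the fraction field of Z[q][t]. *)
Definition Qqt : fieldType := {fraction {poly {poly int}}}.

Definition qvar : Qqt := tofrac ('X%:P : {poly {poly int}}).

Definition tvar : Qqt := tofrac ('X : {poly {poly int}}).

Definition qpoch (n : nat) : Qqt := \prod_(1 <= i < n.+1) (1 - qvar ^+ i).

Definition qbinom (n k : int) : Qqt :=
  if 0 <= k <= n then qpoch `|n| / (qpoch `|k| * qpoch `|n - k|) else 0.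

(* Main.v *)
(* Deleting the principal hook, with arm a and leg b, of a nonempty partition in
   the m x n box whose ranks are all at least 1 - l leaves a partition in the
   b x a box with the same property; the hook itself only has to satisfy
   a < n, b < m and b < a + l.  This determines the coefficients G(n, m, d) of
   (t q)^d by G(n, m, 0) = 1 and
     G(n, m, d + 1) = sum of q^(a + b) G(a, b, d) over such (a, b),
   where b <= a + l holds again.  The closed form, a difference of two products
   of elementary symmetric polynomials in the powers of q, satisfies the same
   recurrence: summing over b telescopes by the q-Pascal rule, and this gives
   the increment in n; at the boundary m = n + l, where the row m allows no pair
   (a, b), the two products contribute the same increment in m. *)
Require Import Defs.
From HB Require Import structures.
From mathcomp Require Import all_boot all_order all_algebra.
From mathcomp Require Import boolp classical_sets fsbigop.
From mathcomp Require Import zify ring.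

Set Implicit Arguments.
Unset Strict Implicit.
Unset Printing Implicit Defensive.

Import Order.TTheory GRing.Theory Num.Theory.
Local Open Scope ring_scope.

(** * Elementary symmetric polynomials of 1, q, ..., q^(n-1) *)

Section PowerEsym.
Variables (F : fieldType) (q : F).
Implicit Types n m k l a b d i : nat.

(** A division-free substitute for the Gaussian binomial: in its Pascal rule the power [q ^+ n']
    does not depend on [k]. *)
Fixpoint pow_esym n k : F :=
  match n, k with
  | _, 0 => 1
  | 0, _.+1 => 0
  | n'.+1, k'.+1 => pow_esym n' k + q ^+ n' * pow_esym n' k'
  end.

(** At [k = 0] the index -1 must give 0, whereas [pow_esym n k.-1] would give 1. *)
Definition pow_esym_pred n k : F := if k is k'.+1 then pow_esym n k' else 0.

Lemma pow_esym0 n : pow_esym n 0 = 1.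
Proof. by case: n. Qed.

Lemma pow_esymS n k :
  pow_esym n.+1 k.+1 = pow_esym n k.+1 + q ^+ n * pow_esym n k.
Proof. by []. Qed.

Lemma pow_esym_predS n k :
  pow_esym_pred n.+1 k.+1 = pow_esym_pred n k.+1 + q ^+ n * pow_esym_pred n k.
Proof. by case: k => [|k] //=; rewrite !pow_esym0 mulr0 addr0. Qed.

Lemma pow_esym_small n k : (n < k)%N -> pow_esym n k = 0.
Proof.
elim: n k => [|n IHn] [|k] //= lt_nk.
by rewrite !IHn ?mulr0 ?addr0 //; lia.
Qed.

(** The factor [q ^+ l] turns the Pascal power q^(m+1-l) into q^(m+1) and keeps the rule valid under
    truncation: for [l > m.+1] every term vanishes. *)
Lemma pow_esym_subS m l k : (0 < k)%N ->
  q ^+ l * pow_esym (m.+2 - l) k.+1 =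
  q ^+ l * pow_esym (m.+1 - l) k.+1 + q ^+ m.+1 * pow_esym (m.+1 - l) k.
Proof.
move=> k_gt0; have [le_lm|lt_ml] := leqP l m.+1.
  by rewrite subSn // pow_esymS mulrDr mulrA -exprD subnKC.
by rewrite !pow_esym_small ?mulr0 ?addr0 //; lia.
Qed.

(* The coefficient of (t q)^d in the right-hand side of the theorem.  The
   truncations [(n + l).-1] and [m.+1 - l] are harmless when [m <= n + l]:
   wherever they differ from the integers, [pow_esym (m.+1 - l) d.+1] or
   [pow_esym_pred _ d] vanishes. *)
Definition ranked_coef l n m d : F :=
  pow_esym n d * pow_esym m d
  - q ^+ l / q * (pow_esym_pred (n + l).-1 d * pow_esym (m.+1 - l) d.+1).

Hypothesis q_neq0 : q != 0.

(** By the Pascal rule, q^b times the [b]-dependent factor of either product is a difference of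
    consecutive values. The offset 1 - l in the second product costs another factor [q ^+ l / q]. *)
Lemma sum_ranked_coef l n m d :
  \sum_(b < m) q ^+ b * ranked_coef l n b d =
  pow_esym n d * pow_esym m d.+1
  - (q ^+ l / q) ^+ 2 * (pow_esym_pred (n + l).-1 d * pow_esym (m.+1 - l) d.+2).
Proof.
elim: m => [|m IHm].
  by rewrite big_ord0 !(@pow_esym_small _ d.+1, @pow_esym_small _ d.+2) //;
    [ring | lia].
rewrite big_ord_recr /= IHm /ranked_coef /=.
have eqS := @pow_esym_subS m l d.+1 isT.
have -> : (q ^+ l / q) ^+ 2 *
    (pow_esym_pred (n + l).-1 d * pow_esym (m.+2 - l) d.+2) =
  q ^+ l / q ^+ 2 * pow_esym_pred (n + l).-1 d *
    (q ^+ l * pow_esym (m.+2 - l) d.+2).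
  by field.
by rewrite eqS (exprS _ m); field.
Qed.

Lemma ranked_coef_rowS l n m d : (m <= n + l)%N ->
  ranked_coef l n.+1 m d.+1 =
  ranked_coef l n m d.+1 + \sum_(b < m) q ^+ (n + b) * ranked_coef l n b d.
Proof.
move=> le_mnl; under eq_bigr do rewrite exprD -mulrA.
rewrite -mulr_sumr sum_ranked_coef /ranked_coef pow_esymS.
case: l le_mnl => [|l] le_mnl; last first.
  rewrite addSn !addnS -[X in pow_esym_pred X.+1.-1]/(n + l).+1 pow_esym_predS.
  by rewrite exprS exprD; field.
(* If [n = l = 0], the predecessor is truncated and the Pascal rule fails, but then [m = 0] and the
   second products vanish. *)
case: n le_mnl => [|n]; rewrite addn0 => le_mn.
  rewrite (_ : m = 0)%N ?(@pow_esym_small (1 - 0)) //=; last by lia.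
  by ring.
rewrite addn0 -[X in pow_esym_pred X.+1.-1]/(n.+1) pow_esym_predS /=.
by rewrite exprS; field.
Qed.

(* At the boundary [m = n + l + 1] the two products cancel: no new pair of
   an arm below n + 1 and a leg equal to n + l is allowed. *)
Lemma ranked_coef_boundary l n d :
  ranked_coef l n.+1 (n + l).+1 d.+1 = ranked_coef l n.+1 (n + l) d.+1.
Proof.
rewrite /ranked_coef (_ : (n + l).+2 - l = n.+2)%N; last by lia.
rewrite (_ : (n + l).+1 - l = n.+1)%N ?addSn; last by lia.
rewrite (pow_esymS (n + l)) (pow_esymS n.+1) exprS exprD.
by set u := pow_esym n.+1 _; rewrite /=; field.
Qed.

Lemma ranked_coef_rec l n m d : (m <= n + l)%N ->
  ranked_coef l n m d.+1 =
  \sum_(a < n) \sum_(b < m | (b < a + l)%N) q ^+ (a + b) * ranked_coef l a b d.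
Proof.
elim: n m => [|n IHn] m.
  rewrite add0n big_ord0 => le_ml; rewrite /ranked_coef /=.
  by rewrite (@pow_esym_small (m.+1 - l)); [ring | lia].
have row m' : (m' <= n + l)%N -> ranked_coef l n.+1 m' d.+1 =
    \sum_(a < n.+1) \sum_(b < m' | (b < a + l)%N)
      q ^+ (a + b) * ranked_coef l a b d.
  move=> le_mnl; rewrite ranked_coef_rowS // IHn // big_ord_recr /=.
  (* In the last row [a = n], the condition [b < n + l] follows from [b < m']. *)
  by congr +%R; apply: eq_bigl => b; have := ltn_ord b; lia.
rewrite addSn leq_eqVlt ltnS => /predU1P[->|/row //].
rewrite ranked_coef_boundary row //; apply: eq_bigr => a _.
(* The new leg [b = n + l] violates [b < a + l] for every [a <= n]. *)
rewrite [RHS]big_mkcond big_ord_recr -big_mkcond /= ifF ?addr0 //.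
by have := ltn_ord a; lia.
Qed.

End PowerEsym.

(** * Adding and removing the principal hook of a partition *)

Lemma is_partition_cons x s :
  is_partition (x :: s) = [&& (0 < x)%N, all (geq x) s & is_partition s].
Proof.
rewrite /is_partition /= path_sortedE => [|? ? ? /= le1 le2]; last first.
  exact: leq_trans le2 le1.
by rewrite inE negb_or eq_sym -lt0n andbCA !andbA.
Qed.

Lemma part1_leq n la : is_partition la -> (part la 1 <= n)%N = all (geq n) la.
Proof.
case: la => [|x s] //; rewrite is_partition_cons => /and3P[_ /allP xs _].
rewrite /part /=; have [le_xn|//] := leqP x n.
by apply/esym/allP => y /xs /= le_yx; apply: leq_trans le_yx le_xn.
Qed.

Lemma durfee_leq_size la : (durfee la <= size la)%N.
Proof.
rewrite /durfee big_nat_cond.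
by apply/bigmax_leqP_seq => i _ /andP[/andP[_]].
Qed.

Lemma durfee_leq n la : all (geq n) la -> (durfee la <= n)%N.
Proof.
move=> /allP le_la; rewrite /durfee big_nat_cond; apply/bigmax_leqP_seq => i _.
case/andP=> /andP[i_gt0 le_i] le_ip; apply: leq_trans le_ip _.
by case: i i_gt0 le_i => // i _ lt_i; apply: (le_la _ (mem_nth _ _)).
Qed.

(* The partition whose first row is [a + 1], whose first column is [b + 1], and
   which becomes [mu] when both are deleted. *)
Definition hook a b mu : seq nat :=
  a.+1 :: (map succn mu ++ nseq (b - size mu) 1%N).

Definition del_first_col (s : seq nat) : seq nat := [seq y <- map predn s | (0 < y)%N].

Lemma hook_del_first_col x s : is_partition (x :: s) ->
  x :: s = hook x.-1 (size s) (del_first_col s).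
Proof.
rewrite is_partition_cons /hook => /and3P[x_gt0 _ part_s].
rewrite prednK //; congr (x :: _).
elim: s part_s => [|[|[|y]] s IHs] //; rewrite is_partition_cons => /and3P[//= _].
  move=> le_s1 part_s; rewrite -/(del_first_col s).
  (* After a part 1 only parts 1 follow; they are the padding of [hook], and deleting the column
     removes them. *)
  have -> : s = nseq (size s) 1%N.
    apply/all_pred1P/allP => y y_s; have := allP le_s1 _ y_s.
    by case: y y_s part_s => [|[|y]] // y_s /andP[_]; rewrite y_s.
  have del_col_nseq1 k : del_first_col (nseq k 1%N) = [::] by elim: k.
  by rewrite -[1%N :: _]/(nseq (size s).+1 1%N) del_col_nseq1 /= size_nseq.
by move=> _ part_s; rewrite -/(del_first_col s) /= -IHs.
Qed.

Lemma del_first_col_hook a b mu : 0%N \notin mu -> del_first_col (behead (hook a b mu)) = mu.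
Proof.
move=> mu0; rewrite /del_first_col /= map_cat filter_cat -map_comp (eq_map (g := id)) //.
rewrite map_id map_nseq [X in _ ++ X](_ : _ = [::]); last by elim: (b - _)%N.
rewrite cats0; apply/all_filterP/allP => y y_mu; rewrite lt0n.
by apply: contraNneq mu0 => <-.
Qed.

Lemma size_del_first_col s : (size (del_first_col s) <= size s)%N.
Proof. by rewrite size_filter (leq_trans (count_size _ _)) ?size_map. Qed.

Lemma all_del_first_col n s : all (geq n) s -> all (geq n.-1) (del_first_col s).
Proof.
move=> /allP le_sn; apply/allP => y; rewrite mem_filter => /andP[_].
by case/mapP=> z /le_sn /= le_zn ->; lia.
Qed.

Lemma is_partition_del_first_col s : is_partition s -> is_partition (del_first_col s).
Proof.
elim: s => [|[|[|y]] s IHs] //; rewrite is_partition_cons => /and3P[//= _] le_s.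
move=> /IHs part_s; rewrite /del_first_col /= -/(del_first_col s) is_partition_cons part_s.
by rewrite (all_del_first_col le_s).
Qed.

Section Hook.
Variables (a b : nat) (mu : seq nat).
Hypotheses (part_mu : is_partition mu) (mu_le_a : all (geq a) mu).
Hypothesis size_mu : (size mu <= b)%N.

Lemma size_hook : size (hook a b mu) = b.+1.
Proof. by rewrite /= size_cat size_map size_nseq subnKC. Qed.

Lemma hook_partition : is_partition (hook a b mu).
Proof.
rewrite is_partition_cons all_cat all_map all_nseq orbT andbT.
rewrite [all _ _]mu_le_a /=.
elim: mu part_mu (b - _)%N => [_|x s IHs].
  by elim=> [|k IHk] //=; rewrite is_partition_cons all_nseq orbT.
rewrite is_partition_cons => /and3P[_ le_sx part_s] k.
by rewrite /= is_partition_cons all_cat all_map all_nseq orbT andbT IHs // andbT.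
Qed.

Lemma sumn_hook : sumn (hook a b mu) = ((a + b).+1 + sumn mu)%N.
Proof.
rewrite /= sumn_cat sumn_nseq mul1n.
have -> : sumn (map succn mu) = (size mu + sumn mu)%N.
  by elim: (mu) => //= x s ->; lia.
by move: size_mu; lia.
Qed.

Lemma part_hookS i : (0 < i <= b)%N ->
  part (hook a b mu) i.+1 = (part mu i).+1.
Proof.
case: i => // i /= lt_ib; rewrite /part /= nth_cat size_map.
case: ltnP => [lt_i|le_i]; first by rewrite (nth_map 0%N).
(* Below the rows of [mu], the padding 1 is the successor of the default part 0. *)
by rewrite nth_nseq [nth _ mu _]nth_default // ifT //; lia.
Qed.

Lemma conj_part_hookS i : (0 < i <= a)%N ->
  conj_part (hook a b mu) i.+1 = (conj_part mu i).+1.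
Proof.
case: i => // i /= lt_ia.
by rewrite /conj_part /= ltnS lt_ia count_cat count_map count_nseq mul0n addn0.
Qed.

Lemma conj_part_hook1 : conj_part (hook a b mu) 1 = b.+1.
Proof.
rewrite -size_hook; apply/eqP; rewrite -all_count; apply/allP => y y_h.
by rewrite lt0n; apply: contraTneq y_h => ->; case/andP: hook_partition.
Qed.

(** Index 1 always qualifies, and i + 1 qualifies for the hook exactly when i does for [mu]. Keeping
    the 1 in the maximum covers an empty range. *)
Lemma durfee_hook : durfee (hook a b mu) = (durfee mu).+1.
Proof.
rewrite /durfee size_hook big_ltn_cond //= big_add1 /=.
have -> : (\max_(1 <= i < b.+1 | i.+1 <= part (hook a b mu) i.+1) i.+1 =
          \max_(1 <= i < b.+1 | i <= part mu i) i.+1)%N.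
  rewrite big_nat_cond [RHS]big_nat_cond; apply: eq_bigl => i.
  by apply: andb_id2l => lt_i; rewrite part_hookS.
have -> : (\max_(1 <= i < b.+1 | i <= part mu i) i.+1 =
           \max_(1 <= i < (size mu).+1 | i <= part mu i) i.+1)%N.
  rewrite (@big_cat_nat _ _ _ (size mu).+1) //=.
  rewrite [X in maxn _ X]big_nat_cond [X in maxn _ X]big_pred0 ?maxn0 // => i.
  apply/negP => /andP[/andP[lt_i _]].
  by rewrite /part nth_default; lia.
rewrite -[LHS]/(maxn 1 _).
elim/big_rec2: _ => // i x y _ IH.
by rewrite maxnCA IH maxnSS.
Qed.

Lemma srank_hook1 : srank (hook a b mu) 1 = a%:Z - b%:Z.
Proof. by rewrite /srank conj_part_hook1 /part /=; lia. Qed.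

(** The new column lengthens the row and the new row lengthens the column, so the difference is
    unchanged; the Durfee bound gives [i <= a] and [i <= b]. *)
Lemma srank_hookS i : (0 < i <= durfee mu)%N ->
  srank (hook a b mu) i.+1 = srank mu i.
Proof.
move=> /andP[i_gt0 le_i]; rewrite /srank part_hookS ?conj_part_hookS ?i_gt0 /=.
- lia.
- exact: leq_trans le_i (durfee_leq mu_le_a).
- exact: leq_trans le_i (leq_trans (durfee_leq_size mu) size_mu).
Qed.

Lemma ranked_hook l n m :
  ranked_partitions m n (1 - l%:Z) (hook a b mu) <->
  [/\ (a < n)%N, (b < m)%N, (b < a + l)%N &
      ranked_partitions b a (1 - l%:Z) mu].
Proof.
split=> [[_] | [lt_an lt_bm lt_bal [_ _ _ rank_mu]]].
  rewrite size_hook => lt_bm lt_an rank_h; split=> //.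
    by have := rank_h 1%N; rewrite durfee_hook srank_hook1 => /(_ isT); lia.
  split=> //; first by rewrite part1_leq.
  move=> i /andP[i_gt0 le_i].
  by rewrite -srank_hookS ?i_gt0 //; apply: rank_h; rewrite durfee_hook.
split=> //; [exact: hook_partition | by rewrite size_hook | ].
case=> [|[|i]] //; rewrite durfee_hook => le_i; first by rewrite srank_hook1; lia.
by rewrite srank_hookS //; apply: rank_mu.
Qed.

End Hook.

(** * Enumeration by principal hooks and the generating function *)

(* The argument [f] is fuel for the recursion: any [f >= m] gives the same
   list. *)
Fixpoint ranked_seq l f n m : seq (seq nat) :=
  [::] :: if f is f'.+1 then
    [seq hook ab.1 ab.2 mu |
      ab <- [seq ab <- [seq (a, b) | a <- index_iota 0 n, b <- index_iota 0 m]
               | (ab.2 < ab.1 + l)%N],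
      mu <- ranked_seq l f' ab.1 ab.2]
  else [::].

Lemma mem_arm_leg l n m a b :
  ((a, b) \in [seq ab <- [seq (a, b) | a <- index_iota 0 n,
                                       b <- index_iota 0 m]
                | (ab.2 < ab.1 + l)%N]) =
  [&& (a < n)%N, (b < m)%N & (b < a + l)%N].
Proof.
rewrite mem_filter /= andbC andbA; congr (_ && _).
apply/allpairsP/andP => [[[c d] /= [+ + [-> ->]]]|[lt_a lt_b]].
  by rewrite !mem_index_iota.
by exists (a, b); rewrite !mem_index_iota.
Qed.

(** Fuel [f >= m] suffices because the recursive calls replace [m] by a leg [b < m]. *)
Lemma mem_ranked_seq l f n m la : (m <= f)%N ->
  la \in ranked_seq l f n m <-> ranked_partitions m n (1 - l%:Z) la.
Proof.
elim: f n m la => [|f IHf] n m la le_mf.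
  rewrite inE; split=> [/eqP->|[_ le_m _ _]]; last by case: la le_m => //=; lia.
  by split=> // i; rewrite /durfee big_geq //; lia.
rewrite inE; case: la => [|x s].
  split=> // _; split=> // i; rewrite /durfee big_geq //; lia.
split=> [/= /allpairsPdep[[a b] [mu [+ /=]]] | rk_la].
  rewrite mem_arm_leg => /and3P[lt_a lt_b lt_ba].
  rewrite IHf => [rk_mu ->|]; last by lia.
  have [part_mu sz_mu] := rk_mu; rewrite part1_leq // => le_mu _.
  by apply/ranked_hook.
have [part_la _ _ _] := rk_la.
have /and3P[_ le_sx part_s] : [&& (0 < x)%N, all (geq x) s & is_partition s].
  by rewrite -is_partition_cons.
move: rk_la; rewrite (hook_del_first_col part_la) ranked_hook ?size_del_first_col //; last 2 first.
- exact: is_partition_del_first_col.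
- exact: all_del_first_col.
case=> lt_x lt_s lt_sx rk_mu.
apply/allpairsPdep; exists (x.-1, size s), (del_first_col s).
by rewrite mem_arm_leg lt_x lt_s lt_sx; split=> //=; apply/IHf => //; lia.
Qed.

(** A hook determines its data: [mu] by deleting row and column, [b] from the size, [a] from the
    first part. *)
Lemma uniq_ranked_seq l f n m : (m <= f)%N -> uniq (ranked_seq l f n m).
Proof.
elim: f n m => [|f IHf] n m le_mf //=; apply/andP; split.
  by apply/negP => /allpairsPdep[ab [mu []]].
have mu_ok a b mu : (b <= f)%N -> mu \in ranked_seq l f a b ->
    0%N \notin mu /\ (size mu <= b)%N.
  by move=> le_b /(mem_ranked_seq _ _ _ le_b)[/andP[_]].
apply: allpairs_uniq_dep.
- by rewrite filter_uniq // allpairs_uniq ?iota_uniq // => -[? ?] [? ?].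
- case=> a b; rewrite mem_arm_leg => /and3P[_ lt_b _].
  exact: IHf (leq_trans lt_b le_mf).
move=> u v /allpairsPdep[[a b] [mu [+ /= mu_in ->]]].
rewrite mem_arm_leg => /and3P[_ lt_b _].
move=> /allpairsPdep[[a' b'] [mu' [+ /= mu'_in ->]]] /=.
rewrite mem_arm_leg => /and3P[_ lt_b' _] eq_h.
have [mu0 sz_mu] := mu_ok _ _ _ (leq_trans lt_b le_mf) mu_in.
have [mu'0 sz_mu'] := mu_ok _ _ _ (leq_trans lt_b' le_mf) mu'_in.
have eq_mu : mu = mu'.
  by rewrite -(del_first_col_hook a b mu0) -(del_first_col_hook a' b' mu'0) eq_h.
have /eqP := congr1 size eq_h; rewrite !size_hook // eqSS => /eqP eq_b.
by case: eq_h => eq_a _; rewrite eq_a eq_b eq_mu.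
Qed.

Lemma sum_ranked_seq (F : fieldType) (q t : F) l f n m :
  q != 0 -> (m <= f)%N -> (m <= n + l)%N ->
  \sum_(la <- ranked_seq l f n m) t ^+ durfee la * q ^+ sumn la =
  \sum_(i < f.+1) (t * q) ^+ i * ranked_coef q l n m i.
Proof.
move=> q_neq0; elim: f n m => [|f IHf] n m le_mf le_mnl.
  by rewrite big_seq1 big_ord1 /ranked_coef !pow_esym0 /durfee big_geq //=; ring.
rewrite [ranked_seq _ _ _ _]/= big_cons big_ord_recl big_allpairs_dep; congr +%R.
  by rewrite /ranked_coef !pow_esym0 /durfee big_geq //=; ring.
(* The hook has a + b + 1 cells and adds one to the Durfee side, hence the weight t q q^(a+b). *)
transitivity (\sum_(ab <- [seq ab <- [seq (a, b) | a <- index_iota 0 n,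
                                                   b <- index_iota 0 m]
                             | (ab.2 < ab.1 + l)%N])
   t * q * q ^+ (ab.1 + ab.2) *
   \sum_(i < f.+1) (t * q) ^+ i * ranked_coef q l ab.1 ab.2 i).
  apply: eq_big_seq => -[a b]; rewrite mem_arm_leg => /and3P[_ lt_bm lt_bal].
  rewrite [(a, b).1]/= [(a, b).2]/=.
  have le_bf : (b <= f)%N by lia.
  rewrite -IHf //; last by lia.
  rewrite mulr_sumr; apply: eq_big_seq => mu.
  move=> /(mem_ranked_seq _ _ _ le_bf)[part_mu sz_mu].
  rewrite part1_leq // => le_mu _.
  by rewrite durfee_hook // sumn_hook // !exprS !exprD; ring.
rewrite big_filter big_mkcond big_allpairs_dep /=.
under [RHS]eq_bigr => i _.
  rewrite [bump 0 i]add1n exprS ranked_coef_rec // -mulrA mulr_sumr mulr_sumr.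
  over.
rewrite [RHS]exchange_big big_mkord; apply: eq_bigr => a _.
under [RHS]eq_bigr do rewrite mulr_sumr mulr_sumr.
rewrite [RHS]exchange_big -big_mkcond big_mkord; apply: eq_bigr => b _.
by rewrite mulr_sumr; apply: eq_bigr => i _; ring.
Qed.

(** * Link with the Gaussian binomial coefficients *)

Lemma qvar_neq0 : qvar != 0.
Proof. by rewrite tofrac_eq0 polyC_eq0 polyX_eq0. Qed.

Lemma subr1_qvarX_neq0 i : 1 - qvar ^+ i.+1 != 0.
Proof.
rewrite -tofracXn -tofrac1 -tofracB tofrac_eq0 -polyC_exp -polyCB polyC_eq0.
by rewrite -oppr_eq0 opprB -size_poly_eq0 size_XnsubC.
Qed.

Lemma qpochS n : qpoch n.+1 = qpoch n * (1 - qvar ^+ n.+1).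
Proof. by rewrite /qpoch big_nat_recr. Qed.

Lemma qpoch0 : qpoch 0 = 1.
Proof. by rewrite /qpoch big_geq. Qed.

Lemma qpoch_neq0 n : qpoch n != 0.
Proof.
elim: n => [|n IHn]; first by rewrite qpoch0 oner_neq0.
by rewrite qpochS mulf_neq0 ?subr1_qvarX_neq0.
Qed.

Lemma qbinom_nat n k :
  qbinom n%:Z k%:Z =
  if (k <= n)%N then qpoch n / (qpoch k * qpoch (n - k)) else 0.
Proof.
rewrite /qbinom lez_nat /=; case: leqP => // le_kn.
by rewrite subzn.
Qed.

(** The q-Pascal rule with x = q^(n-k), y = q^(k+1), P = (q)_n, R = (q)_k and S = (q)_(n-k-1). *)
Lemma pascal_fraction (F : fieldType) (x y P R S : F) :
  R != 0 -> S != 0 -> 1 - x != 0 -> 1 - y != 0 ->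
  P * (1 - x * y) / (R * (1 - y) * (S * (1 - x))) =
  P / (R * (1 - y) * S) + x * (P / (R * (S * (1 - x)))).
Proof. by move=> R0 S0 x0 y0; field; rewrite !(R0, S0, x0, y0). Qed.

Lemma qbinomS n k : (k <= n)%N ->
  qbinom n.+1%:Z k.+1%:Z =
  qbinom n%:Z k.+1%:Z + qvar ^+ (n - k) * qbinom n%:Z k%:Z.
Proof.
rewrite !qbinom_nat ltnS subSS => le_kn; rewrite le_kn.
case: ltnP => [lt_kn | le_nk].
  rewrite !qpochS (_ : n - k = (n - k.+1).+1)%N; last by lia.
  rewrite qpochS -pascal_fraction ?qpoch_neq0 ?subr1_qvarX_neq0 //.
  by rewrite -exprD; congr (_ * (1 - _ ^+ _) / _); lia.
have -> : k = n by lia.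
by rewrite subnn qpoch0 !mulr1 add0r mul1r !divff ?qpoch_neq0.
Qed.

(** The two Pascal rules agree since C(k+1, 2) + (n - k) = n + C(k, 2). *)
Lemma pow_esym_qbinom n k :
  pow_esym qvar n k = qvar ^+ 'C(k, 2) * qbinom n%:Z k%:Z.
Proof.
elim: n k => [|n IHn] [|k].
- by rewrite qbinom_nat /= qpoch0 !mul1r invr1.
- by rewrite qbinom_nat /= mulr0.
- by rewrite qbinom_nat pow_esym0 /= subn0 qpoch0 !mul1r divff ?qpoch_neq0.
rewrite pow_esymS !IHn; have [le_kn | lt_nk] := leqP k n.
  rewrite qbinomS // mulrDr !mulrA -!exprD; congr (_ + qvar ^+ _ * _).
  by rewrite binS bin1; lia.
by rewrite !qbinom_nat !ifF ?mulr0 ?addr0 //; lia.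
Qed.

Lemma sqrn_bin2 i : (i ^ 2 = i + ('C(i, 2) + 'C(i, 2)))%N.
Proof. by elim: i => // i; rewrite binS bin1; lia. Qed.

Lemma ranked_coef_qbinom l n m i : (m <= n + l)%N ->
  qvar ^+ i * ranked_coef qvar l n m i =
  qvar ^+ (i ^ 2) *
    (qbinom n%:Z i%:Z * qbinom m%:Z i%:Z
     - qvar ^+ l * qbinom (n%:Z + l%:Z - 1) (i%:Z - 1)
                 * qbinom (m%:Z - l%:Z + 1) (i%:Z + 1)).
Proof.
move=> le_mnl; rewrite /ranked_coef !mulrBr; congr (_ - _).
  by rewrite !pow_esym_qbinom sqrn_bin2 !exprD; ring.
case: i => [|i] /=; first by rewrite [qbinom (_ - 1) _]/qbinom; ring.
have -> : i.+1%:Z - 1 = i%:Z by lia.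
have -> : i.+1%:Z + 1 = i.+2%:Z by lia.
have [le_lm | lt_ml] := leqP l m.+1; last first.
  (* Here m - l + 1 is negative, and the second product is 0 in both forms. *)
  rewrite (@pow_esym_small _ _ (m.+1 - l)); last by lia.
  by rewrite [qbinom (m%:Z - _ + 1) _]/qbinom ifF ?mulr0 //; lia.
have -> : m%:Z - l%:Z + 1 = (m.+1 - l)%:Z by lia.
(* If [n = l = 0], then n + l - 1 is truncated, but [m = 0] and the other factor has lower index
   above its upper index 1. *)
have [nl_gt0 | nl0] := ltnP 0 (n + l); last first.
  rewrite (@pow_esym_small _ _ (m.+1 - l)); last by lia.
  by rewrite [qbinom (_ - l)%N _]qbinom_nat ifF ?mulr0 //; lia.
have -> : n%:Z + l%:Z - 1 = (n + l).-1%:Z by lia.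
rewrite !pow_esym_qbinom.
set u := qbinom _ _; set v := qbinom _ _.
have eq_bin : (i.+1 ^ 2 = i + 'C(i, 2) + 'C(i.+2, 2))%N.
  by have := sqrn_bin2 i; rewrite (binS i.+1) (binS i) !bin1; lia.
have {2}<- : qvar * (qvar ^+ l / qvar) = qvar ^+ l.
  by rewrite mulrC divfK ?qvar_neq0.
by rewrite eq_bin !exprD exprS; move: (_ / _) => w; ring.
Qed.

Theorem theorem1p5 (m n l : nat) (hnlm : (m <= n + l)%N) :
  \sum_(la \in ranked_partitions m n (1 - l%:Z)) tvar ^+ durfee la * qvar ^+ sumn la =
  \sum_(i \in [set: nat]%classic)
    tvar ^+ i * qvar ^+ (i ^ 2) *
    (qbinom n%:Z i%:Z * qbinom m%:Z i%:Z
     - qvar ^+ l * qbinom (n%:Z + l%:Z - 1) (i%:Z - 1)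
                 * qbinom (m%:Z - l%:Z + 1) (i%:Z + 1)).
Proof.
have eq_set : [set` ranked_seq l m n m]%classic = ranked_partitions m n (1 - l%:Z).
  by apply/predeqP => la; exact: mem_ranked_seq (leqnn m).
rewrite -eq_set -fsbig_seq ?uniq_ranked_seq //.
rewrite sum_ranked_seq ?qvar_neq0 //; symmetry.
rewrite (@fsbigE _ _ _ _ _ (index_iota 0 m.+1)) ?iota_uniq //.
  rewrite (eq_bigl xpredT) => [|i]; last exact: in_setT.
  rewrite big_mkord; apply: eq_bigr => i _.
  by rewrite -mulrA -ranked_coef_qbinom // exprMn mulrA.
(* For [i > m] both products vanish, so the sum over all naturals has finite support. *)
move=> i _; rewrite mem_index_iota -leqNgt /= => lt_mi.
rewrite -mulrA -ranked_coef_qbinom // /ranked_coef.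
rewrite (@pow_esym_small _ _ m) ?(@pow_esym_small _ _ (m.+1 - l)) //; last by lia.
by rewrite !mulr0 subr0 !mulr0.
Qed.
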